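(* Let $J:\mathbb{R}^n\to\mathbb{R}$ satisfy: (1) $J$ is continuously differentiable on $\mathbb{R}^n$; (2) there is a unique minimizer $\theta_*\in\mathbb{R}^n$, i.e. $J(\theta_* )<J(\theta)$ for all $\theta\neq\theta_*$; (3) $\nabla J(\theta)=0$ if and only if $\theta=\theta_*$; (4) $J$ is radially unbounded, i.e. $J(\theta)\to\infty$ as $\|\theta\|\to\infty$. For each $i=1,\dots,n$, the equilibrium value $v_{i,*}$ of the average squared-gradient-magnitude estimate satisfies $v_{i,*}\to 0$ as $a_0\to 0$, where $$v_{i,*}=\frac1T\int_0^T m_i(\tau)^2\left(J(\theta_*+s(\tau))-\xi_*\right)^2d\tau,\qquad \xi_*=\frac1T\int_0^T J(\theta_*+s(\tau))\,d\tau .$$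
   Context: Here $s(t)=(s_1(t),\dots,s_n(t))$ with $s_i(t)=a_i\sin(\omega r_i t)$, $m_i(t)=\frac{2}{a_i}\sin(\omega r_i t)$, $\omega>0$, $T=2\pi/\omega$, the $r_i$ are fixed nonzero integers, $a_i\neq0$, and $a_0=\sqrt{\sum_{i=1}^n a_i^2}$. The limit $a_0\to0$ is taken with the ratios $a_i/a_0$ (all nonzero) held fixed. The quantities $\xi_*$ and $v_{i,*}$ are the equilibrium components, at $\theta=\theta_*$, of the averaged filter equations $\dot{\bar\xi}=\omega_\xi(\bar J(\theta)-\bar\xi)$ and $\dot{\bar{\hat v}}_i=\omega_{l,i}\left(\overline{\hat g_i^2}(\theta,\bar\xi)-\bar{\hat v}_i\right)$, where $\bar J(\theta)=\frac1T\int_0^T J(\theta+s(\tau))d\tau$ and $\overline{\hat g_i^2}(\theta,\xi)=\frac1T\int_0^T m_i(\tau)^2(J(\theta+s(\tau))-\xi)^2d\tau$, with constants $\omega_\xi,\omega_{l,i}>0$. *)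

(* Defs.v *)
From HB Require Import structures.
From mathcomp Require Import all_boot all_order all_algebra.
From mathcomp Require Import all_classical all_reals all_analysis.
Set Implicit Arguments.
Unset Strict Implicit.
Unset Printing Implicit Defensive.
Import Order.TTheory GRing.Theory Num.Theory.
Import numFieldNormedType.Exports.
Local Open Scope classical_set_scope.
Local Open Scope ring_scope.

(** The norm [`|x|] that the library puts on ['rV[R]_n] is the sup norm. *)
Definition enorm (R : realType) (n : nat) (x : 'rV[R]_n) : R :=
  Num.sqrt (\sum_(i < n) x 0 i ^+ 2).

Definition gradient (R : realType) (n : nat) (J : 'rV[R]_n -> R)
    (theta : 'rV[R]_n) : 'rV[R]_n :=
  \row_(i < n) 'D_(delta_mx 0 i) J theta.

Definition continuously_differentiable (R : realType) (n : nat)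
    (J : 'rV[R]_n -> R) : Prop :=
  (forall theta, differentiable J theta) /\ continuous (gradient J).

Definition radially_unbounded (R : realType) (n : nat) (J : 'rV[R]_n -> R) :
    Prop :=
  forall M : R, exists rho : R,
    forall theta, rho < enorm theta -> M < J theta.

Definition period (R : realType) (omega : R) : R := 2 * pi / omega.

(** The integral is the real-valued Lebesgue integral; it is only applied to
    integrands that are continuous in [t] when [J] is continuous. *)
Definition period_mean (R : realType) (omega : R) (f : R -> R) : R :=
  (period omega)^-1 *
  \int[@lebesgue_measure R]_(t in `[0, period omega]) f t.

Section Filter.
Variables (R : realType) (n : nat) (J : 'rV[R]_n -> R).
Variables (omega : R) (r : 'I_n -> int) (a : 'rV[R]_n).

Definition dither (t : R) : 'rV[R]_n :=
  \row_(i < n) (a 0 i * sin (omega * (r i)%:~R * t)).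

Definition demod (i : 'I_n) (t : R) : R :=
  2 / a 0 i * sin (omega * (r i)%:~R * t).

Definition averaged_cost (theta : 'rV[R]_n) : R :=
  period_mean omega (fun tau => J (theta + dither tau)).

Definition averaged_sq_gradient (theta : 'rV[R]_n) (xi : R) (i : 'I_n) : R :=
  period_mean omega
    (fun tau => demod i tau ^+ 2 * (J (theta + dither tau) - xi) ^+ 2).

(** Equilibria, with [theta] frozen, of
      xi'  = omega_xi * (averaged_cost theta - xi),
      v_i' = omega_l i * (averaged_sq_gradient theta xi i - v_i). *)
Definition averaged_filter_equilibrium (omega_xi : R) (omega_l : 'I_n -> R)
    (theta : 'rV[R]_n) (xi : R) (v : 'I_n -> R) : Prop :=
  omega_xi * (averaged_cost theta - xi) = 0 /\
  forall i, omega_l i * (averaged_sq_gradient theta xi i - v i) = 0.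

Definition xi_eq (theta : 'rV[R]_n) : R := averaged_cost theta.

Definition v_eq (theta : 'rV[R]_n) (i : 'I_n) : R :=
  averaged_sq_gradient theta (xi_eq theta) i.

End Filter.

(* Main.v *)
Require Import Defs.
From HB Require Import structures.
From mathcomp Require Import all_boot all_order all_algebra.
From mathcomp Require Import all_classical all_reals all_analysis.
From mathcomp Require Import ring lra.
Import Order.TTheory GRing.Theory Num.Theory.
Import numFieldNormedType.Exports.
Local Open Scope classical_set_scope.
Local Open Scope ring_scope.

(** At the critical point [theta_star] the first-order term of [J] vanishes, so
    [J (theta_star + s) - J theta_star = o(a0)] uniformly over a period, and the
    mean [xi_*] lies within [o(a0)] of [J theta_star] as well. Since [m_i] is
    only of order [1 / a0], the integrand defining [v_{i,*}] is [o(1)]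
    uniformly over a period. *)

Lemma rV_norm_le (R : realType) (n : nat) (x : 'rV[R]_n) (M : R) :
  0 <= M -> (forall i, `|x 0 i| <= M) -> `|x| <= M.
Proof.
move=> M0 xM; rewrite [`|x|]mx_normrE; apply: bigmax_le => // -[i j] _ /=.
by rewrite (ord1 i).
Qed.

Lemma coord_le_enorm (R : realType) (n : nat) (x : 'rV[R]_n) (i : 'I_n) :
  `|x 0 i| <= enorm x.
Proof.
rewrite -sqrtr_sqr ler_wsqrtr// (bigD1 i)//= lerDl.
by apply: sumr_ge0 => j _; exact: sqr_ge0.
Qed.

Lemma gradient0_littleo {R : realType} {n : nat} {J : 'rV[R]_n -> R}
    {theta : 'rV[R]_n} :
  differentiable J theta -> gradient J theta = 0 ->
  forall eps : R, 0 < eps ->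
    \forall h \near (0 : 'rV[R]_n), `|J (theta + h) - J theta| <= eps * `|h|.
Proof.
move=> dJ gJ eps eps0.
have dJ0 (h : 'rV[R]_n) : 'd J theta h = 0.
  rewrite [h]row_sum_delta linear_sum big1// => i _.
  rewrite linearZ/= -deriveE//.
  by move/rowP: gJ => /(_ i); rewrite !mxE => ->; rewrite scaler0.
near=> h.
rewrite [theta + h]addrC (diff_locallyx dJ) dJ0 addr0 addrAC subrr add0r.
by near: h; exact: littleoP.
Unshelve. all: by end_near. Qed.

Lemma dither_continuous (R : realType) (n : nat) (omega : R) (r : 'I_n -> int)
    (a : 'rV[R]_n) : continuous (dither omega r a).
Proof.
move=> t; apply/cvgrPdist_le => e e0.
have coord i : \forall u \near t,
    `|a 0 i * sin (omega * (r i)%:~R * t) -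
      a 0 i * sin (omega * (r i)%:~R * u)| <= e.
  have : {for t, continuous (fun u => a 0 i * sin (omega * (r i)%:~R * u))}.
    apply: cvgM; first exact: cvg_cst.
    apply: continuous_comp; last exact: continuous_sin.
    by apply: cvgM; [exact: cvg_cst|exact: cvg_id].
  by move/cvgrPdist_le; apply.
apply: filterS (filter_forall _ coord) => u ue; apply: rV_norm_le => [|i]; first exact: ltW.
by rewrite !mxE; exact: ue.
Qed.

Lemma dither_norm_le (R : realType) (n : nat) (omega : R) (r : 'I_n -> int)
    (a : 'rV[R]_n) (t : R) : `|dither omega r a t| <= enorm a.
Proof.
apply: rV_norm_le => [|i]; first exact: sqrtr_ge0.
rewrite mxE normrM; apply: (le_trans _ (coord_le_enorm _ _ a i)).
by rewrite ler_piMr// ler_norml sin_geN1 sin_le1.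
Qed.

Lemma period_mean_bounds (R : realType) (omega : R) (f : R -> R) (l u : R) :
  0 < omega -> continuous f -> (forall t, l <= f t <= u) ->
  l <= period_mean omega f <= u.
Proof.
move=> omega0 cf lfu.
have T0 : 0 < period omega by rewrite divr_gt0// mulr_gt0// pi_gt0.
have int_cont (g : R -> R) : continuous g ->
    (@lebesgue_measure R).-integrable `[0, period omega] (EFin \o g).
  move=> cg; apply: continuous_compact_integrable.
    exact: segment_compact.
  exact: continuous_subspaceT.
have int_cst (k : R) :
    \int[@lebesgue_measure R]_(t in `[0, period omega]) k = k * period omega.
  by rewrite Rintegral_cst//= lebesgue_measure_itv/= lte_fin T0 sube0.
rewrite /period_mean mulrC ler_pdivlMr// ler_pdivrMr// -!int_cst.
apply/andP; split; apply: le_Rintegral => //.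
- by apply: int_cont; exact: cst_continuous.
- exact: int_cont.
- by move=> t _; case/andP: (lfu t).
- exact: int_cont.
- by apply: int_cont; exact: cst_continuous.
- by move=> t _; case/andP: (lfu t).
Qed.

Lemma v_eq_bounds (R : realType) (n : nat) (J : 'rV[R]_n -> R) (omega : R)
    (r : 'I_n -> int) (a theta : 'rV[R]_n) (k e : R) (i : 'I_n) :
  0 < omega -> continuous J ->
  (forall t, `|J (theta + dither omega r a t) - k| <= e) ->
  0 <= v_eq J omega r a theta i <= (2 / a 0 i) ^+ 2 * (2 * e) ^+ 2.
Proof.
move=> omega0 cJ Je.
have cJs : continuous (fun t => J (theta + dither omega r a t)).
  move=> t; apply: continuous_comp; last exact: cJ.
  by apply: cvgD; [exact: cvg_cst|exact: dither_continuous].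
have xib : k - e <= xi_eq J omega r a theta <= k + e.
  by apply: period_mean_bounds => // t; rewrite -ler_distl.
apply: period_mean_bounds => // [t|t].
  apply: cvgM.
    apply: (@cvg_comp _ _ _ _ (fun x : R => x ^+ 2)); last exact: exprn_continuous.
    apply: cvgM; first exact: cvg_cst.
    apply: continuous_comp; last exact: continuous_sin.
    by apply: cvgM; [exact: cvg_cst|exact: cvg_id].
  apply: (@cvg_comp _ _ _ _ (fun x : R => x ^+ 2)); last exact: exprn_continuous.
  by apply: cvgB; [exact: cJs|exact: cvg_cst].
rewrite mulr_ge0 ?sqr_ge0//=.
apply: ler_pM; rewrite ?sqr_ge0//.
  by rewrite /demod exprMn ler_piMr ?sqr_ge0//.
have := Je t; rewrite ler_distl => Jt.
rewrite -[leLHS]real_normK ?num_real// ler_sqr ?nnegrE//; last lra.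
by rewrite ler_norml; lra.
Qed.

(* [a a0] is the amplitude vector of Euclidean norm [a0] whose ratios
   [a_i / a0] are the fixed numbers [c i]. *)
Theorem corollary1 (R : realType) (n : nat) (J : 'rV[R]_n -> R)
    (theta_star : 'rV[R]_n) (omega omega_xi : R) (omega_l : 'I_n -> R)
    (r : 'I_n -> int) (c : 'I_n -> R) (a : R -> 'rV[R]_n)
    (J_C1 : continuously_differentiable J)
    (J_min : forall theta, theta <> theta_star -> J theta_star < J theta)
    (J_crit : forall theta, gradient J theta = 0 <-> theta = theta_star)
    (J_unbounded : radially_unbounded J)
    (omega_gt0 : 0 < omega) (omega_xi_gt0 : 0 < omega_xi)
    (omega_l_gt0 : forall i, 0 < omega_l i)
    (r_neq0 : forall i, r i <> 0) (c_neq0 : forall i, c i <> 0)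
    (a_norm : forall a0 : R, 0 < a0 -> enorm (a a0) = a0)
    (a_ratio : forall a0 : R, 0 < a0 -> forall i, a a0 0 i / a0 = c i) :
  (forall a0 : R, 0 < a0 -> forall (xi : R) (v : 'I_n -> R),
     averaged_filter_equilibrium J omega r (a a0) omega_xi omega_l
       theta_star xi v <->
     xi = xi_eq J omega r (a a0) theta_star /\
     forall i, v i = v_eq J omega r (a a0) theta_star i) /\
  (forall i, v_eq J omega r (a a0) theta_star i @[a0 --> 0^'+] --> 0).
Proof.
split.
  move=> a0 a00 xi v; split=> [[/eqP]|[-> vE]].
    rewrite mulf_eq0 gt_eqF//= subr_eq0 => /eqP <- vE; split=> // i.
    have /eqP := vE i.
    by rewrite mulf_eq0 gt_eqF//= subr_eq0 => /eqP <-.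
  by split=> [|i]; rewrite ?vE subrr mulr0.
move=> i; have [dJ _] := J_C1.
have cJ : continuous J by move=> theta; exact: differentiable_continuous.
apply/cvgr0Pnorm_le => e e0.
have ci0 : 0 < `|c i| by rewrite normr_gt0; apply/eqP.
have eps0 : 0 < `|c i| * Num.sqrt e / 4.
  by rewrite divr_gt0// mulr_gt0// sqrtr_gt0.
have gJ : gradient J theta_star = 0 by apply/J_crit.
have [d /= d0 Jd] := nbhs_norm0P.1 (gradient0_littleo (dJ _) gJ _ eps0).
near=> a0.
have a00 : 0 < a0 by near: a0; exact: nbhs_right_gt.
have a0d : a0 < d by near: a0; exact: nbhs_right_lt.
have aE : a a0 0 i = c i * a0 by rewrite -(a_ratio _ a00) divfK// gt_eqF.
have Ja0 t : `|J (theta_star + dither omega r (a a0) t) - J theta_star| <=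
    `|c i| * Num.sqrt e / 4 * a0.
  have sa0 : `|dither omega r (a a0) t| <= a0.
    by rewrite -[leRHS]a_norm// dither_norm_le.
  apply: le_trans (Jd _ _) _; first exact: le_lt_trans sa0 a0d.
  by rewrite ler_wpM2l// ltW.
have /andP[v0 ve] := v_eq_bounds _ _ _ _ _ _ _ _ _ i omega_gt0 cJ Ja0.
rewrite ger0_norm//; apply: le_trans ve _.
rewrite aE le_eqVlt; apply/orP; left; apply/eqP.
rewrite !exprMn real_normK ?num_real// sqr_sqrtr ?ltW// !exprVn exprMn.
by field; rewrite gt_eqF//=; apply/eqP.
Unshelve. all: by end_near.
Qed.
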